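(* There is a unique periodic triangulation of $\mathbb{Z}^3$ up to $\mathrm{GL}_3(\mathbb{Z})$-equivalence.
   Context: A periodic triangulation of $\mathbb{Z}^n$ is a collection $\mathcal{T}$ of $n$-dimensional simplices in $\mathbb{R}^n$ whose set of vertices is $\mathbb{Z}^n$, which cover $\mathbb{R}^n$, such that the intersection of any two simplices of $\mathcal{T}$ is a (possibly empty) face of both, and such that $\mathcal{T}+v=\mathcal{T}$ for every $v\in\mathbb{Z}^n$. Two periodic triangulations $\mathcal{T},\mathcal{T}'$ of $\mathbb{Z}^n$ are $\mathrm{GL}_n(\mathbb{Z})$-equivalent if $\mathcal{T}'=g\mathcal{T}$ for some $g\in\mathrm{GL}_n(\mathbb{Z})$. *)

(* Defs.v *)
From HB Require Import structures.
From mathcomp Require Import all_boot all_order all_algebra.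
From mathcomp Require Import all_classical all_reals.

Set Implicit Arguments.
Unset Strict Implicit.
Unset Printing Implicit Defensive.

Import Order.TTheory GRing.Theory Num.Theory.

Local Open Scope classical_set_scope.
Local Open Scope ring_scope.

Section PeriodicTriangulations.
Variables (R : realType) (n : nat).
Implicit Types (F S : set 'cV[R]_n) (T : set (set 'cV[R]_n)).

Definition affinely_independent m (v : 'I_m -> 'cV[R]_n) : Prop :=
  forall c : 'I_m -> R,
    \sum_i c i = 0 -> \sum_i c i *: v i = 0 -> forall i, c i = 0.

(* The convex hull of the points v i for i in A; it is empty when A is empty,
   since the weights have to add up to 1. *)
Definition hull m (v : 'I_m -> 'cV[R]_n) (A : {set 'I_m}) : set 'cV[R]_n :=
  [set x | exists c : 'I_m -> R,
     [/\ forall i, 0 <= c i, forall i, i \notin A -> c i = 0,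
         \sum_i c i = 1 & x = \sum_i c i *: v i]].

Definition simplex_with_vertices (v : 'I_n.+1 -> 'cV[R]_n) S : Prop :=
  affinely_independent v /\ S = hull v [set: 'I_n.+1]%SET.

Definition full_simplex S : Prop := exists v, simplex_with_vertices v S.

(* A simplex determines its vertices up to order, so the choice of v in the
   next two definitions is immaterial. *)
Definition simplex_vertices S : set 'cV[R]_n :=
  [set x | exists v, simplex_with_vertices v S /\ exists i, x = v i].

Definition face F S : Prop :=
  exists v (A : {set 'I_n.+1}), simplex_with_vertices v S /\ F = hull v A.

Definition int_vec (z : 'cV[int]_n) : 'cV[R]_n := map_mx intr z.

Definition translate (z : 'cV[int]_n) T : set (set 'cV[R]_n) :=
  [set [set x + int_vec z | x in S] | S in T].

Definition int_mx_image (g : 'M[int]_n) T : set (set 'cV[R]_n) :=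
  [set [set map_mx intr g *m x | x in S] | S in T].

Record periodic_triangulation T : Prop := {
  pt_simplices : forall S, T S -> full_simplex S;
  pt_vertices : \bigcup_(S in T) simplex_vertices S = range int_vec;
  pt_cover : \bigcup_(S in T) S = setT;
  pt_faces : forall S S', T S -> T S' ->
    face (S `&` S') S /\ face (S `&` S') S';
  pt_periodic : forall z, translate z T = T
}.

(* Over int, g \in unitmx means that g is invertible with an integral inverse,
   i.e. that g is in GL_n(Z). *)
Definition GLZ_equivalent T T' : Prop :=
  exists2 g : 'M[int]_n, g \in unitmx & T' = int_mx_image g T.

End PeriodicTriangulations.

(* Main.v *)
Require Import Defs.
From mathcomp Require Import all_boot all_order all_algebra all_fingroup.
From mathcomp Require Import all_classical all_reals.
From mathcomp Require Import zify ring lra.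

(* Everything follows from the arithmetic of midpoints modulo 2.  If two edges
   of a periodic triangulation have midpoints differing by a lattice vector z,
   then translating one simplex by z makes the edges share an interior point,
   so the edges are parallel translates of each other.  Hence the six edges of
   a tetrahedron have distinct nonzero classes modulo 2, and the seventh class
   is that of the sum of the vertices.  This makes every tetrahedron
   unimodular: otherwise reducing barycentric coordinates modulo 1 gives a
   lattice point sum r_i u_i with 0 <= r_i < 1; sum r_i = 1 or 3 would give a
   lattice point of the tetrahedron other than its vertices, and if
   sum r_i = 2 then half of sum r_i u_i or of sum (1 - r_i) u_i would be a point
   of the tetrahedron in the class of an edge midpoint or of a vertex.

   The point (u_0 + u_1 + u_2 + u_3) / 2 is therefore the midpoint of an edge
   of some tetrahedron, whose third vertex shows that its direction is, up to
   relabelling, (u_1 - u_0) + (u_3 - u_2).  In the basis u_(i+1) - u_i all edge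
   directions of the triangulation are then 0/1 vectors up to sign, so its
   tetrahedra are those of the Freudenthal triangulation. *)

Set Implicit Arguments.
Unset Strict Implicit.
Unset Printing Implicit Defensive.

Import Order.TTheory GRing.Theory Num.Theory.

Local Open Scope classical_set_scope.
Local Open Scope ring_scope.

(** * Kronecker weights *)

Section Delta.
Variables (K : nzRingType) (m : nat) (i : 'I_m).

Lemma sum_delta : \sum_j (j == i)%:R = 1 :> K.
Proof. by rewrite (bigD1 i) //= eqxx big1 ?addr0 // => j /negPf ->. Qed.

Lemma sum_scale_delta (V : lmodType K) (v : 'I_m -> V) :
  \sum_j ((j == i)%:R : K) *: v j = v i.
Proof.
rewrite (bigD1 i) //= eqxx scale1r big1 ?addr0 // => j /negPf ->.
by rewrite scale0r.
Qed.

End Delta.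

(** * Barycentric coordinates, convex hulls and vertices of simplices *)

Section Barycentric.
Variables (R : realType) (n : nat).
Implicit Types (m : nat) (S : set 'cV[R]_n).

Lemma barycentric_inj m (v : 'I_m -> 'cV[R]_n) (c d : 'I_m -> R) :
  affinely_independent v -> \sum_i c i = \sum_i d i ->
  \sum_i c i *: v i = \sum_i d i *: v i -> c =1 d.
Proof.
move=> vI cd cdv i; apply/eqP; rewrite -subr_eq0; apply/eqP.
apply: (vI (fun i => c i - d i)).
  by rewrite big_split /= sumrN cd subrr.
by under eq_bigr do rewrite scalerBl; rewrite big_split /= sumrN cdv subrr.
Qed.

Lemma affinely_independent_inj m (v : 'I_m -> 'cV[R]_n) :
  affinely_independent v -> injective v.
Proof.
move=> vI i j vij; apply/eqP.
have := barycentric_inj (c := fun k => (k == i)%:R)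
  (d := fun k => (k == j)%:R) vI.
rewrite !sum_delta !sum_scale_delta => /(_ erefl vij i); rewrite eqxx.
by case: (i == j) => // /eqP; rewrite oner_eq0.
Qed.

Lemma hull_vertex m (v : 'I_m -> 'cV[R]_n) (A : {set 'I_m}) i :
  i \in A -> hull v A (v i).
Proof.
move=> iA; exists (fun k => (k == i)%:R); split.
- by move=> k; rewrite ler0n.
- by move=> k kA; case: eqVneq => // ki; rewrite ki iA in kA.
- exact: sum_delta.
- by rewrite sum_scale_delta.
Qed.

Lemma hull_support m (v : 'I_m -> 'cV[R]_n) (A : {set 'I_m}) (c : 'I_m -> R) :
  affinely_independent v -> \sum_i c i = 1 -> hull v A (\sum_i c i *: v i) ->
  forall i, c i != 0 -> i \in A.
Proof.
move=> vI c1 [d [_ dA d1 cd]] i ci; apply/negPn/negP => /dA di.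
have := barycentric_inj vI _ cd; rewrite c1 d1 => /(_ erefl i); rewrite di => ci0.
by rewrite ci0 eqxx in ci.
Qed.

Lemma hull_le1 m (c : 'I_m -> R) i :
  (forall i, 0 <= c i) -> \sum_i c i = 1 -> c i <= 1.
Proof.
move=> c0 <-; rewrite (bigD1 i) //= lerDl.
by apply: sumr_ge0 => k _; exact: c0.
Qed.

Lemma delta_of_sum1 m (c : 'I_m -> R) i :
  (forall i, 0 <= c i) -> \sum_i c i = 1 -> c i = 1 ->
  forall j, c j = (j == i)%:R.
Proof.
move=> c0 c1 ci j; case: eqVneq => [->//|ji].
have /eqP : \sum_(k | k != i) c k = 0.
  by move: c1; rewrite (bigD1 i) //= ci => /(canRL (addKr _)); rewrite addNr.
rewrite psumr_eq0 => [/allP/(_ j)|k _]; last exact: c0.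
by rewrite mem_index_enum ji => /(_ isT)/eqP.
Qed.

(** Composes two layers of convex combinations. The guard [c k != 0] allows weights that vanish off
    a face: only the points actually used have to lie in the hull. *)
Lemma hull_weights m p (v : 'I_m -> 'cV[R]_n) (u : 'I_p -> 'cV[R]_n)
    (c : 'I_p -> R) : \sum_k c k = 1 ->
  (forall k, c k != 0 -> hull v [set: 'I_m]%SET (u k)) ->
  exists d : 'I_p -> 'I_m -> R,
    [/\ forall k, c k != 0 ->
          [/\ forall j, 0 <= d k j, \sum_j d k j = 1 &
              u k = \sum_j d k j *: v j],
        \sum_j \sum_k c k * d k j = 1 &
        \sum_k c k *: u k = \sum_j (\sum_k c k * d k j) *: v j].
Proof.
move=> c1 uh.
have /choice [d dP] : forall k, exists d : 'I_m -> R, c k != 0 ->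
    [/\ forall j, 0 <= d j, \sum_j d j = 1 & u k = \sum_j d j *: v j].
  move=> k; case: (eqVneq (c k) 0) => [_|/uh[d [d0 _ d1 ud]]]; last by exists d.
  by exists (fun=> 0).
exists d; split => //.
- rewrite exchange_big /= -[RHS]c1; apply: eq_bigr => k _.
  rewrite -mulr_sumr; case: (eqVneq (c k) 0) => [->|/dP[_ -> _]].
    by rewrite mul0r.
  by rewrite mulr1.
- under [RHS]eq_bigr do rewrite scaler_suml.
  rewrite exchange_big /=; apply: eq_bigr => k _.
  under [RHS]eq_bigr do rewrite -scalerA.
  rewrite -scaler_sumr; case: (eqVneq (c k) 0) => [->|/dP[_ _ <-] //].
  by rewrite !scale0r.
Qed.

Lemma hull_convex m p (v : 'I_m -> 'cV[R]_n) (u : 'I_p -> 'cV[R]_n)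
    (c : 'I_p -> R) :
  (forall k, 0 <= c k) -> \sum_k c k = 1 ->
  (forall k, c k != 0 -> hull v [set: 'I_m]%SET (u k)) ->
  hull v [set: 'I_m]%SET (\sum_k c k *: u k).
Proof.
move=> c0 c1 uh; have [d [dP d1 ->]] := hull_weights c1 uh.
exists (fun j => \sum_k c k * d k j); split => // j; last by rewrite inE.
apply: sumr_ge0 => k _; case: (eqVneq (c k) 0) => [->|/dP[d0 _ _]].
  by rewrite mul0r.
exact: mulr_ge0.
Qed.

(* Vertices are extreme points: a convex combination equal to a vertex of a
   simplex uses only that vertex. *)
Lemma hull_extreme m p (v : 'I_m -> 'cV[R]_n) (u : 'I_p -> 'cV[R]_n)
    (c : 'I_p -> R) i :
  affinely_independent v -> (forall k, 0 <= c k) -> \sum_k c k = 1 ->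
  (forall k, c k != 0 -> hull v [set: 'I_m]%SET (u k)) ->
  v i = \sum_k c k *: u k -> exists k, v i = u k.
Proof.
move=> vI c0 c1 uh vic; have [d [dP d1 ud]] := hull_weights c1 uh.
have ci : \sum_k c k * d k i = 1.
  have := barycentric_inj (c := fun j => \sum_k c k * d k j)
     (d := fun k => (k == i)%:R) vI.
  rewrite sum_delta sum_scale_delta vic => -> //.
  by rewrite eqxx.
have /eqP : \sum_k c k * (1 - d k i) = 0.
  under eq_bigr do rewrite mulrBr mulr1.
  by rewrite big_split /= sumrN c1 ci subrr.
have dge k : 0 <= c k * (1 - d k i).
  case: (eqVneq (c k) 0) => [->|/dP[d0 dk1 _]]; first by rewrite mul0r.
  by rewrite mulr_ge0 // subr_ge0; exact: hull_le1.
rewrite psumr_eq0 // => /allP all0.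
have [k ck] : exists k, c k != 0.
  apply/existsP; apply: contraT; rewrite negb_exists => /forallP h.
  have : \sum_k c k = 0 by apply: big1 => k _; apply/eqP/negPn/h.
  by rewrite c1 => /eqP; rewrite oner_eq0.
have [d0 dk1 uk] := dP k ck; exists k.
have := all0 k; rewrite mem_index_enum => /(_ isT).
rewrite mulf_eq0 (negPf ck) subr_eq0 => /eqP/esym dki.
rewrite uk -(sum_scale_delta i v); apply: eq_bigr => j _.
by rewrite (delta_of_sum1 d0 dk1 dki).
Qed.

Lemma hull_perm m (v : 'I_m -> 'cV[R]_n) (s : 'S_m) :
  hull (v \o s) [set: 'I_m]%SET = hull v [set: 'I_m]%SET.
Proof.
apply/seteqP; split => x [c [c0 _ c1 xc]].
  exists (c \o s^-1%g); split => [k|k|//|]; first exact: c0.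
  - by rewrite inE.
  - rewrite -c1 [RHS](reindex_inj (@perm_inj _ s^-1%g)) /=; exact: eq_bigr.
  - rewrite xc [LHS](reindex_inj (@perm_inj _ s^-1%g)) /=.
    by apply: eq_bigr => k _; rewrite permKV.
exists (c \o s); split => [k|k|//|]; first exact: c0.
- by rewrite inE.
- rewrite -c1 [RHS](reindex_inj (@perm_inj _ s)) /=; exact: eq_bigr.
- by rewrite xc [LHS](reindex_inj (@perm_inj _ s)).
Qed.

Lemma affinely_independent_perm m (v : 'I_m -> 'cV[R]_n) (s : 'S_m) :
  affinely_independent v -> affinely_independent (v \o s).
Proof.
move=> vI c c0 cv i; rewrite -(permK s i).
apply: (vI (c \o s^-1%g)).
  rewrite -[RHS]c0 [RHS](reindex_inj (@perm_inj _ s^-1%g)) /=; exact: eq_bigr.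
rewrite -[RHS]cv [RHS](reindex_inj (@perm_inj _ s^-1%g)) /=.
by apply: eq_bigr => k _; rewrite permKV.
Qed.

Lemma simplex_with_vertices_perm (v : 'I_n.+1 -> 'cV[R]_n) (s : 'S_n.+1) S :
  simplex_with_vertices v S -> simplex_with_vertices (v \o s) S.
Proof.
by move=> [vI ->]; split; [exact: affinely_independent_perm|rewrite hull_perm].
Qed.

Lemma simplex_vertices_range (v v' : 'I_n.+1 -> 'cV[R]_n) S i :
  simplex_with_vertices v S -> simplex_with_vertices v' S ->
  exists j, v i = v' j.
Proof.
move=> [vI ->] [v'I vv'].
have [c [c0 _ c1 vic]] : hull v' [set: 'I_n.+1]%SET (v i).
  by rewrite -vv'; apply: hull_vertex; rewrite inE.
apply: (hull_extreme vI c0 c1 _ vic) => k _.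
by rewrite vv'; apply: hull_vertex; rewrite inE.
Qed.

(** The rows [(1, v i)] form a square matrix of size [n + 1]. Affine independence says that it is
    row free, hence invertible, and the weights solve the linear system with right-hand side
    [(1, x)]. *)
Lemma barycentric_span (v : 'I_n.+1 -> 'cV[R]_n) (x : 'cV[R]_n) :
  affinely_independent v ->
  exists2 c : 'I_n.+1 -> R, \sum_i c i = 1 & x = \sum_i c i *: v i.
Proof.
move=> vI; pose M : 'M[R]_n.+1 := \matrix_(i, j < 1 + n)
   row_mx (1%:M : 'M_1) (v i)^T 0 j.
have MU : row_free M.
  rewrite -kermx_eq0.
  apply/eqP/row_matrixP => i; rewrite row0.
  have : row i (kermx M) *m M = 0 by apply/sub_kermxP/row_sub.
  move: (row i _) => c cM.
  have E j : (c *m M) 0 j = 0 by rewrite cM mxE.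
  suff c0 : forall i, c 0 i = 0 by apply/rowP => k; rewrite c0 mxE.
  apply: vI.
    have := E (lshift n (0 : 'I_1)); rewrite mxE => {}E; rewrite -[RHS]E.
    by apply: eq_bigr => k _; rewrite !mxE (unsplitK (inl _)) mxE eqxx mulr1.
  apply/colP => j; have := E (rshift 1 j).
  rewrite mxE => {}E; rewrite summxE [RHS]mxE -[RHS]E; apply: eq_bigr => k _.
  by rewrite !mxE (unsplitK (inr _)) !mxE.
pose y : 'rV[R]_(1 + n) := row_mx (1%:M : 'M_1) x^T.
have [c yc] : exists c : 'rV[R]_n.+1, y = c *m M.
  exists (y *m invmx M); rewrite mulmxKV // -row_free_unit //.
exists (fun i => c 0 i).
  have := congr1 (fun z : 'rV_(1 + n) => z 0 (lshift n (0 : 'I_1))) yc.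
  rewrite /y row_mxEl !mxE eqxx => cE; apply/esym; apply: (etrans cE).
  by apply: eq_bigr => k _; rewrite !mxE (unsplitK (inl _)) mxE eqxx mulr1.
apply/colP => j.
have := congr1 (fun z : 'rV_(1 + n) => z 0 (rshift 1 j)) yc.
rewrite /y row_mxEr mxE => ->; rewrite mxE summxE; apply: eq_bigr => k _.
by rewrite !mxE (unsplitK (inr _)) !mxE.
Qed.

End Barycentric.

(** * Lattice points and edges in a periodic triangulation *)

Section Lattice.
Variables (R : realType) (n : nat).
Implicit Types (S : set 'cV[R]_n) (u : 'I_n.+1 -> 'cV[int]_n) (z : 'cV[int]_n).

Lemma int_vec_inj : injective (@int_vec R n).
Proof.
move=> x y /colP xy; apply/colP => i.
by have := xy i; rewrite !mxE => /intr_inj.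
Qed.

Lemma int_vecD : {morph @int_vec R n : x y / x + y}.
Proof. by move=> x y; rewrite /int_vec raddfD. Qed.

Lemma int_vecZ k z : int_vec R (k *: z) = k%:~R *: int_vec R z.
Proof. by rewrite /int_vec map_mxZ. Qed.

Lemma int_vec_sum I (r : seq I) (k : I -> int) (w : I -> 'cV[int]_n) :
  int_vec R (\sum_(i <- r) k i *: w i) =
  \sum_(i <- r) (k i)%:~R *: int_vec R (w i).
Proof. by rewrite /int_vec raddf_sum; apply: eq_bigr => i _; exact: int_vecZ. Qed.

Definition lattice_simplex u S : Prop :=
  simplex_with_vertices (fun i => int_vec R (u i)) S.

Lemma lattice_simplex_perm u (s : 'S_n.+1) S :
  lattice_simplex u S -> lattice_simplex (u \o s) S.
Proof. exact: simplex_with_vertices_perm. Qed.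

Lemma lattice_simplex_vertex_inj u S : lattice_simplex u S -> injective u.
Proof.
move=> [/affinely_independent_inj uI _] i j uij; apply: uI => /=.
by rewrite uij.
Qed.

Lemma simplex_mem_vertex (v : 'I_n.+1 -> 'cV[R]_n) S i :
  simplex_with_vertices v S -> S (v i).
Proof. by case=> _ ->; apply: hull_vertex; rewrite inE. Qed.

Lemma simplex_memP (v : 'I_n.+1 -> 'cV[R]_n) S x : simplex_with_vertices v S ->
  S x <-> exists c : 'I_n.+1 -> R,
    [/\ forall i, 0 <= c i, \sum_i c i = 1 & x = \sum_i c i *: v i].
Proof.
case=> _ ->; split=> [[c [c0 _ c1 xc]]|[c [c0 c1 xc]]]; exists c => //.
by split=> // i; rewrite inE.
Qed.

Lemma simplex_midpoint (v : 'I_n.+1 -> 'cV[R]_n) S i j :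
  simplex_with_vertices v S -> S (2^-1 *: (v i + v j)).
Proof.
move=> vS; apply/(simplex_memP _ vS).
exists (fun k => 2^-1 * ((k == i)%:R + (k == j)%:R)); split.
- by move=> k; rewrite mulr_ge0 ?invr_ge0 ?addr_ge0 ?ler0n.
- rewrite -mulr_sumr big_split /= !sum_delta; lra.
- under eq_bigr do rewrite -scalerA scalerDl.
  by rewrite -scaler_sumr big_split /= !sum_scale_delta.
Qed.

Lemma simplex_with_vertices_translate (v : 'I_n.+1 -> 'cV[R]_n) S t :
  simplex_with_vertices v S ->
  simplex_with_vertices (fun i => v i + t) [set x + t | x in S].
Proof.
move=> vS; have [vI _] := vS; split.
  move=> c c0 cv; apply: vI => //; rewrite -[RHS]cv.
  under [RHS]eq_bigr do rewrite scalerDr.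
  by rewrite big_split /= -scaler_suml c0 scale0r addr0.
apply/seteqP; split => [_ [x /(simplex_memP _ vS)[c [c0 c1 ->]] <-]|x].
  exists c; split => // [i|]; first by rewrite inE.
  under [RHS]eq_bigr do rewrite scalerDr.
  by rewrite big_split /= -scaler_suml c1 scale1r.
move=> [c [c0 _ c1 xc]]; exists (\sum_i c i *: v i).
  by apply/(simplex_memP _ vS); exists c.
rewrite xc; under [RHS]eq_bigr do rewrite scalerDr.
by rewrite big_split /= -scaler_suml c1 scale1r.
Qed.

Lemma lattice_simplex_translate u S z : lattice_simplex u S ->
  lattice_simplex (fun i => u i + z) [set x + int_vec R z | x in S].
Proof.
move=> /(simplex_with_vertices_translate (int_vec R z)).
rewrite /lattice_simplex; under [X in _ -> simplex_with_vertices X _]funext => i.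
  rewrite int_vecD; over.
by [].
Qed.

Lemma lattice_simplex_inj u S (k l : 'I_n.+1 -> int) :
  lattice_simplex u S -> \sum_i k i = \sum_i l i ->
  \sum_i k i *: u i = \sum_i l i *: u i -> k =1 l.
Proof.
move=> [uI _] kl klu i; apply: (@intr_inj R).
apply: (barycentric_inj (c := fun i => (k i)%:~R) (d := fun i => (l i)%:~R) uI).
  by rewrite -!rmorph_sum kl.
by rewrite -!int_vec_sum klu.
Qed.

Lemma vertex_pair_inj u S i j k l : lattice_simplex u S ->
  u i + u j = u k + u l -> (i = k /\ j = l) \/ (i = l /\ j = k).
Proof.
move=> uS e.
have E : (fun p => (p == i)%:R + (p == j)%:R : int) =1
         (fun p => (p == k)%:R + (p == l)%:R).
  apply: (lattice_simplex_inj uS); first by rewrite !big_split /= !sum_delta.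
  under eq_bigr do rewrite scalerDl; under [RHS]eq_bigr do rewrite scalerDl.
  by rewrite !big_split /= !sum_scale_delta.
have Ei := E i; have Ej := E j; rewrite !eqxx in Ei Ej.
move: Ei Ej; rewrite (eq_sym j i).
case: (eqVneq i k) => [<-|ik]; case: (eqVneq i l) => [<-|il];
  case: (eqVneq j k) => [jk|jk]; case: (eqVneq j l) => [jl|jl];
  case: (eqVneq i j) => [ij|ij] //=; subst; rewrite ?eqxx //; auto.
all: by move: ik il jk jl ij; rewrite ?eqxx // => *; auto.
Qed.

Variable T : set (set 'cV[R]_n).
Hypothesis hT : periodic_triangulation T.

Lemma mem_translate S z : T S -> T [set x + int_vec R z | x in S].
Proof. by move=> TS; rewrite -(pt_periodic hT z); exists S. Qed.

Lemma lattice_simplexE S : T S -> exists u, lattice_simplex u S.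
Proof.
move=> TS; have [v vS] := pt_simplices hT TS.
have /choice[u uv] : forall i, exists z, v i = int_vec R z.
  move=> i; have : (\bigcup_(S in T) simplex_vertices S) (v i).
    by exists S => //; exists v; split => //; exists i.
  by rewrite (pt_vertices hT) => -[z _ <-]; exists z.
by exists u; rewrite /lattice_simplex -(funext uv).
Qed.

(** The lattice point is a vertex of some [S'], hence an extreme point of [S']. It also lies in the
    common face of [S] and [S'], so it is a convex combination of vertices of [S] that belong to
    [S'], and must be one of them. *)
Lemma lattice_point_vertex S u z : T S -> lattice_simplex u S ->
  S (int_vec R z) -> exists i, z = u i.
Proof.
move=> TS uS Sz.
have : (\bigcup_(S in T) simplex_vertices S) (int_vec R z).
  by rewrite (pt_vertices hT); exists z.
move=> [S' TS' [v' [vS' [i zi]]]].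
have [[v [A [vS SS']]] _] := pt_faces hT TS TS'.
have : (S `&` S') (int_vec R z).
  by split => //; rewrite zi; exact: simplex_mem_vertex vS'.
rewrite SS' => -[c [c0 cA c1 zc]].
have [||k zk] := hull_extreme (i := i) (u := v) vS'.1 c0 c1.
- move=> k ck; have kA : k \in A by apply: contraNT ck => /cA ->.
  have := hull_vertex v kA; rewrite -SS' => -[_].
  by case: vS' => _ ->.
- by rewrite -zi.
have [j] := simplex_vertices_range k vS uS.
by rewrite -zk -zi => /int_vec_inj ->; exists j.
Qed.

(** The midpoint of the translated edge lies in the common face of [S'] and [S + z]. A face
    containing the midpoint of an edge contains both its ends, and these are lattice points of [S'],
    hence vertices of it. *)
Lemma edge_translate S S' u u' i j z : T S -> T S' ->
  lattice_simplex u S -> lattice_simplex u' S' ->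
  S' (2^-1 *: int_vec R (u i + u j + z *+ 2)) ->
  exists k l, u' k = u i + z /\ u' l = u j + z.
Proof.
move=> TS TS' uS uS'.
pose S1 := [set x + int_vec R z | x in S].
have TS1 : T S1 by exact: mem_translate.
have uS1 : lattice_simplex (fun i => u i + z) S1.
  exact: lattice_simplex_translate.
have -> : u i + u j + z *+ 2 = (u i + z) + (u j + z).
  by rewrite mulr2n addrACA.
rewrite int_vecD => mS'.
have [_ [v [A [vS1 SA]]]] := pt_faces hT TS' TS1.
have [a ia] := simplex_vertices_range i uS1 vS1.
have [b jb] := simplex_vertices_range j uS1 vS1.
have : (S' `&` S1) (2^-1 *: (v a + v b)).
  by split; [rewrite -ia -jb|exact: simplex_midpoint].
have -> : 2^-1 *: (v a + v b) =
    \sum_k (2^-1 * ((k == a)%:R + (k == b)%:R)) *: v k.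
  under eq_bigr do rewrite -scalerA scalerDl.
  by rewrite -scaler_sumr big_split /= !sum_scale_delta.
rewrite SA => /(hull_support vS1.1) kA.
have {}kA k : (k == a) || (k == b) -> (S' `&` S1) (v k).
  move=> kab; rewrite SA; apply: hull_vertex; apply: kA.
    by rewrite -mulr_sumr big_split /= !sum_delta; lra.
  by rewrite mulf_neq0 ?invr_eq0 ?pnatr_eq0 // -natrD pnatr_eq0 addn_eq0
    !eqb0 negb_and !negbK.
have [|aS' _] := kA a; first by rewrite eqxx.
have [|bS' _] := kA b; first by rewrite eqxx orbT.
have [|k ek] := lattice_point_vertex (z := u i + z) TS' uS'.
  by rewrite ia.
have [|l el] := lattice_point_vertex (z := u j + z) TS' uS'.
  by rewrite jb.
by exists k, l.
Qed.

(* Two edges whose sums of endpoints are congruent modulo 2 have midpoints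
   which differ by a lattice vector, so they are parallel translates. *)
Lemma edge_congr S S' u u' i j a b z : T S -> T S' ->
  lattice_simplex u S -> lattice_simplex u' S' ->
  u' i + u' j = u a + u b + z *+ 2 ->
  u' i - u' j = u a - u b \/ u' i - u' j = - (u a - u b).
Proof.
move=> TS TS' uS uS' e.
have [|k [l [ek el]]] := edge_translate (i := a) (j := b) (z := z) TS TS' uS uS'.
  by rewrite -e int_vecD; exact: simplex_midpoint uS'.
have ekl : u' i + u' j = u' k + u' l by rewrite ek el addrACA -mulr2n.
have d : u' k - u' l = u a - u b by rewrite ek el opprD addrACA subrr addr0.
have [[-> ->]|[-> ->]] := vertex_pair_inj uS' ekl; first by left.
by right; rewrite -d opprB.
Qed.

(** The midpoint of the two vertices would be a lattice point of the simplex, hence a vertex, and a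
    vertex is the midpoint only of itself with itself. *)
Lemma vertex_sum_neq_even S u i j z : T S -> lattice_simplex u S ->
  u i + u j = z *+ 2 -> i = j.
Proof.
move=> TS uS e.
have [|k ek] := lattice_point_vertex (z := z) TS uS.
  have -> : int_vec R z = 2^-1 *: (int_vec R (u i) + int_vec R (u j)).
    rewrite -int_vecD e /int_vec raddfMn /= -scaler_nat scalerA mulVf ?scale1r //.
    by rewrite pnatr_eq0.
  exact: simplex_midpoint uS.
have : u i + u j = u k + u k by rewrite -ek e mulr2n.
by case/(vertex_pair_inj uS) => -[-> ->].
Qed.

End Lattice.

(* Entrywise linear arithmetic; the entries are generalized because lia does
   not always recognize them as atoms. *)
Ltac mx_lia :=
  rewrite ?(mulmxnE, mxE);
  repeat match goal with
  | |- context [@fun_of_matrix ?K ?m ?n ?A ?i ?j] =>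
      move: (A i j) => ?
  end; lia.

(** * Tetrahedra: parity classes, unimodularity and edge directions *)

Section Dimension3.
Variable R : realType.
Implicit Types (S : set 'cV[R]_3) (u v : 'I_4 -> 'cV[int]_3) (y z : 'cV[int]_3).

Local Notation o0 := (@Ordinal 4 0 isT).
Local Notation o1 := (@Ordinal 4 1 isT).
Local Notation o2 := (@Ordinal 4 2 isT).
Local Notation o3 := (@Ordinal 4 3 isT).

Local Notation p0 := (@Ordinal 3 0 isT).
Local Notation p1 := (@Ordinal 3 1 isT).
Local Notation p2 := (@Ordinal 3 2 isT).

Lemma sum_I3 (V : zmodType) (F : 'I_3 -> V) : \sum_i F i = F p0 + F p1 + F p2.
Proof.
rewrite !big_ord_recl big_ord0 addr0 !addrA.
by do !congr (_ + _); congr F; apply: val_inj.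
Qed.

Lemma I3P (i : 'I_3) : [\/ i = p0, i = p1 | i = p2].
Proof.
case: i => -[|[|[|//]]] Hi; [constructor 1|constructor 2|constructor 3];
  exact: val_inj.
Qed.

Lemma sum_I4 (V : zmodType) (F : 'I_4 -> V) :
  \sum_i F i = F o0 + F o1 + F o2 + F o3.
Proof.
rewrite !big_ord_recl big_ord0 addr0 !addrA.
by do !congr (_ + _); congr F; apply: val_inj.
Qed.

Lemma I4P (i : 'I_4) : [\/ i = o0, i = o1, i = o2 | i = o3].
Proof.
case: i => -[|[|[|[|//]]]] Hi; [constructor 1|constructor 2|constructor 3|
  constructor 4]; exact: val_inj.
Qed.

Lemma perm_I4 (a b c d : 'I_4) : uniq [:: a; b; c; d] ->
  exists s : 'S_4, [/\ s o0 = a, s o1 = b, s o2 = c & s o3 = d].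
Proof.
move=> U; pose f (i : 'I_4) := nth a [:: a; b; c; d] i.
have fI : injective f.
  by move=> i j /eqP; rewrite nth_uniq //= => /eqP /val_inj.
by exists (perm fI); rewrite !permE.
Qed.

Lemma sum_uniq4 (V : zmodType) (F : 'I_4 -> V) a b c d :
  uniq [:: a; b; c; d] -> \sum_i F i = F a + F b + F c + F d.
Proof.
move=> /perm_I4[s [<- <- <- <-]].
by rewrite (reindex_inj (@perm_inj _ s)) /= sum_I4.
Qed.

Lemma complete_pair (b d : 'I_4) : b != d ->
  exists e f, uniq [:: b; d; e; f].
Proof.
by case: (I4P b) => ->; case: (I4P d) => -> // _;
  solve [exists o0, o1; done|exists o0, o2; done|exists o0, o3; done
        |exists o1, o2; done|exists o1, o3; done|exists o2, o3; done].
Qed.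

Lemma F2_even (k : int) : k%:~R = 0 :> 'F_2 -> exists m, k = m *+ 2.
Proof.
move=> /eqP; rewrite -(dvdz_pcharf (pchar_Fp (isT : prime 2))) => /dvdzP[m ->].
by exists m; lia.
Qed.

Lemma F2_even_vec n (y : 'cV[int]_n) :
  map_mx intr y = 0 :> 'cV['F_2]_n ->
  exists z : 'cV[int]_n, y = z *+ 2.
Proof.
move=> /colP y0.
have /choice[m mP] : forall i, exists m, y i 0 = m *+ 2.
  by move=> i; apply: F2_even; have := y0 i; rewrite !mxE.
by exists (\col_i m i); apply/colP => i; rewrite mulmxnE mxE.
Qed.

Lemma singular_col n (F : fieldType) (A : 'M[F]_n) : A \notin unitmx ->
  exists2 x : 'cV[F]_n, x != 0 & A *m x = 0.
Proof.
rewrite -unitmx_tr -row_free_unit -kermx_eq0 => /rowV0Pn[x /sub_kermxP xA x0].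
exists x^T; first by rewrite trmx_eq0.
by apply: trmx_inj; rewrite trmx_mul trmxK xA trmx0.
Qed.

(* Modulo 2, a nontrivial sum of vectors u_j - u_0 is the sum of the vertices
   over a nonempty even subset: two of them, or all four. *)
Lemma even_subset_sum u (q : 'I_3 -> bool) :
  let s := \sum_j (q j)%:R *: (u (lift ord0 j) - u ord0) in
  (exists j, q j) ->
  (exists i j z, i != j /\ s = u i + u j + z *+ 2) \/
  (exists z, s = \sum_i u i + z *+ 2).
Proof.
move=> s [j0 qj].
have lE (j : 'I_3) (i : 'I_4) : j.+1 = i -> lift ord0 j = i.
  by move=> ji; apply: val_inj; rewrite /= /bump leq0n.
have -> : s = (q p0)%:R *: (u o1 - u o0) + (q p1)%:R *: (u o2 - u o0) +
    (q p2)%:R *: (u o3 - u o0).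
  rewrite /s sum_I3 (lE p0 o1) // (lE p1 o2) // (lE p2 o3) //.
  by rewrite (_ : ord0 = o0) //; apply: val_inj.
have {j0 qj}qj : q p0 || q p1 || q p2.
  by case: (I3P j0) qj => -> ->; rewrite ?orbT.
move: qj; rewrite sum_I4.
case: (q _); case: (q _); case: (q _) => // _;
  rewrite /= ?scale1r ?scale0r ?addr0 ?add0r.
- right; exists (- u o0 *+ 2); apply/colP => i; mx_lia.
- left; exists o1, o2, (- u o0); split => //; apply/colP => i; mx_lia.
- left; exists o1, o3, (- u o0); split => //; apply/colP => i; mx_lia.
- left; exists o0, o1, (- u o0); split => //; apply/colP => i; mx_lia.
- left; exists o2, o3, (- u o0); split => //; apply/colP => i; mx_lia.
- left; exists o0, o2, (- u o0); split => //; apply/colP => i; mx_lia.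
- left; exists o0, o3, (- u o0); split => //; apply/colP => i; mx_lia.
Qed.

Variable T : set (set 'cV[R]_3).
Hypothesis hT : periodic_triangulation T.

(** For [b = d] the sum of all vertices is even, so two opposite edges have congruent sums and would
    be parallel, against affine independence. For [b != d] the two remaining vertices would have an
    even sum. *)
Lemma vertex_sum_not_congr S u b d z : T S -> lattice_simplex u S ->
  \sum_i u i <> u b + u d + z *+ 2.
Proof.
move=> TS uS; case: (eqVneq b d) => [<-|bd].
  rewrite sum_I4 => e.
  have e' : u o0 + u o1 = u o2 + u o3 + (u b + z - u o2 - u o3) *+ 2.
    apply/colP => i; move/colP: e => /(_ i); mx_lia.
  have [] := edge_congr hT TS TS uS uS e' => e2.
    have : u o0 + u o3 = u o2 + u o1.
      apply/colP => i; move/colP: e2 => /(_ i); mx_lia.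
    by case/(vertex_pair_inj uS) => -[].
  have : u o0 + u o2 = u o3 + u o1.
    apply/colP => i; move/colP: e2 => /(_ i); mx_lia.
  by case/(vertex_pair_inj uS) => -[].
have [e [f U]] := complete_pair bd.
rewrite (sum_uniq4 _ U) => E.
have ef : u e + u f = z *+ 2.
  apply/colP => i; move/colP: E => /(_ i); mx_lia.
have := vertex_sum_neq_even hT TS uS ef => fe.
by move: U; rewrite fe /= !inE eqxx !andbF.
Qed.

(* The eight even subsets of the vertices have different sums modulo 2, so
   they represent all the classes of (Z/2)^3. *)
Lemma parity_classes S u y : T S -> lattice_simplex u S ->
  (exists i j z, y = u i + u j + z *+ 2) \/
  (exists z, y = \sum_i u i + z *+ 2).
Proof.
move=> TS uS.
pose D : 'M[int]_3 := \matrix_(i, j) (u (lift ord0 j) - u ord0) i 0.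
pose A : 'M['F_2]_3 := map_mx intr D.
(* [q x] is the support of a vector modulo 2, and [X x] lifts [A *m x] to an integral sum over that
   support. *)
pose q (x : 'cV['F_2]_3) j : bool := x j 0 != 0.
pose X (x : 'cV['F_2]_3) : 'cV[int]_3 :=
  \sum_j ((q x j)%:R : int) *: (u (lift ord0 j) - u ord0).
have qx (x : 'cV['F_2]_3) j : x j 0 = (q x j)%:R :> 'F_2.
  by rewrite /q; move: (x j 0) => -[[|[|//]] Hx] //=; apply: val_inj.
have AX (x : 'cV['F_2]_3) : A *m x = map_mx intr (X x).
  apply/colP => i; rewrite !mxE summxE rmorph_sum; apply: eq_bigr => j _.
  by rewrite !mxE /= qx mulrC rmorphM /= rmorph_nat.
have q0 (x : 'cV['F_2]_3) : x != 0 -> exists j, q x j.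
  move=> x0; apply/existsP; apply: contraNT x0; rewrite negb_exists => /forallP h.
  apply/eqP/colP => j; rewrite mxE; apply/eqP.
  by have := h j; rewrite negbK.
(* A nonzero kernel vector would make the sum over a nonempty even subset of the vertices even: two
   vertices are excluded by [vertex_sum_neq_even], all four by [vertex_sum_not_congr]. *)
have AU : A \in unitmx.
  apply: contraT => /singular_col[x x0].
  rewrite AX => /F2_even_vec[z Xz].
  have [[i [j [z' [ij e]]]]|[z' e]] := even_subset_sum u (q0 x x0).
    have ee : u i + u j = (z - z') *+ 2.
      by rewrite mulrnBl -Xz /X e addrK.
    by rewrite (vertex_sum_neq_even hT TS uS ee) eqxx in ij.
  have ee : \sum_i u i = u o0 + u o0 + (z - z' - u o0) *+ 2.
    by rewrite !mulrnBl -Xz /X e addrK mulr2n addrC subrK.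
  by have := vertex_sum_not_congr TS uS ee.
pose x := invmx A *m map_mx intr y.
have [z yX] : exists z, y - X x = z *+ 2.
  by apply: F2_even_vec; rewrite map_mxB -AX mulKVmx // subrr.
have {yX}-> : y = X x + z *+ 2 by rewrite -yX addrC subrK.
case: (eqVneq x 0) => [->|/q0 qxj].
  left; exists o0, o0, (z - u o0); rewrite /X big1 ?add0r.
    by apply/colP => i; mx_lia.
  by move=> j _; rewrite /q mxE eqxx scale0r.
have [[i [j [z' [_ e]]]]|[z' e]] := even_subset_sum u qxj.
  by left; exists i, j, (z' + z); rewrite mulrnDl [RHS]addrA; congr (_ + _).
by right; exists (z' + z); rewrite mulrnDl [RHS]addrA; congr (_ + _).
Qed.

(** Half of [y] lies in [S] and is the midpoint of a translate of the segment from [u i] to [u j].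
    By [edge_translate] the translated ends are vertices of [S], and uniqueness of barycentric
    coordinates determines [c]. *)
Lemma half_lattice_point S u y (c : 'I_4 -> R) i j z :
  T S -> lattice_simplex u S ->
  (forall i, 0 <= c i) -> \sum_i c i = 2 ->
  int_vec R y = \sum_i c i *: int_vec R (u i) ->
  y = u i + u j + z *+ 2 ->
  exists k l, c =1 fun p => (p == k)%:R + (p == l)%:R.
Proof.
move=> TS uS c0 c2 yc yu.
have yS : S (2^-1 *: int_vec R y).
  apply/(simplex_memP _ uS); exists (fun p => 2^-1 * c p); split.
  - by move=> p; rewrite mulr_ge0 ?invr_ge0 ?ler0n.
  - by rewrite -mulr_sumr c2 mulVf ?pnatr_eq0.
  - by rewrite yc scaler_sumr; apply: eq_bigr => p _; rewrite scalerA.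
rewrite yu in yS.
have [k [l [ek el]]] := edge_translate hT TS TS uS uS yS.
exists k, l; apply: (barycentric_inj uS.1).
  by rewrite c2 big_split /= !sum_delta; lra.
rewrite -yc yu; under [RHS]eq_bigr do rewrite scalerDl.
rewrite big_split /= !sum_scale_delta ek el -int_vecD; congr int_vec.
by rewrite [RHS]addrACA -mulr2n.
Qed.

Lemma third_index (k l : 'I_4) : exists p, (p != k) && (p != l).
Proof.
by case: (I4P k) => ->; case: (I4P l) => ->;
  solve [exists o0; done|exists o1; done|exists o2; done].
Qed.

Lemma unimodular S u y : T S -> lattice_simplex u S ->
  exists2 k : 'I_4 -> int, \sum_i k i = 1 & y = \sum_i k i *: u i.
Proof.
move=> TS uS.
have [x x1 yx] := barycentric_span (int_vec R y) uS.1.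
pose k i := Num.floor (x i).
pose r i := x i - (k i)%:~R.
have r0 i : 0 <= r i by rewrite subr_ge0 floor_le_tmp.
have r1 i : r i < 1 by rewrite ltrBlDl -intrD1 floorD1_gt.
have [N NK] : exists N : int, N = 1 - \sum_i k i by exists (1 - \sum_i k i).
have rN : \sum_i r i = N%:~R.
  by rewrite big_split /= sumrN x1 NK rmorphB /= rmorph_sum.
pose y' := y - \sum_i k i *: u i.
have y'r : int_vec R y' = \sum_i r i *: int_vec R (u i).
  under eq_bigr do rewrite scalerBl.
  rewrite big_split /= sumrN -yx -int_vec_sum.
  by rewrite /y' /int_vec raddfB.
pose y'' := \sum_i u i - y'.
have y''r : int_vec R y'' = \sum_i (1 - r i) *: int_vec R (u i).
  under eq_bigr do rewrite scalerBl scale1r.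
  rewrite big_split /= sumrN -y'r /y'' /int_vec raddfB /=.
  by rewrite raddf_sum.
have N0 : 0 <= N by rewrite -(ler0z R) -rN sumr_ge0.
have N4 : N < 4.
  rewrite -(ltr_int R) -rN sum_I4; have := (r1 o0, r1 o1, r1 o2, r1 o3).
  by case=> -[[]]; lra.
have sN : \sum_i (1 - r i) = (4 - N)%:~R.
  by rewrite big_split /= sumrN rN sumr_const card_ord intrB.
have vertex (c : 'I_4 -> R) w : (forall i, 0 <= c i) -> \sum_i c i = 1 ->
    int_vec R w = \sum_i c i *: int_vec R (u i) ->
    exists j, c =1 fun i => (i == j)%:R.
  move=> c0 c1 wc; have [|j wj] := lattice_point_vertex (z := w) hT TS uS.
    by apply/(simplex_memP _ uS); exists c.
  exists j; apply: (barycentric_inj uS.1); first by rewrite c1 sum_delta.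
  by rewrite sum_scale_delta -wc wj.
have : [\/ N = 0, N = 1, N = 2 | N = 3].
  move: N0 N4; clear; case: N => // -[|[|[|[|n]]]] //= _ _.
  - by constructor 1.
  - by constructor 2.
  - by constructor 3.
  - by constructor 4.
case=> NE; move: rN sN; rewrite NE => rN sN.
- exists k; first by move: NK; rewrite NE; lia.
  apply/eqP; rewrite -subr_eq0 -/y'; apply/eqP/(@int_vec_inj R).
  rewrite y'r /int_vec raddf0; apply: big1 => i _.
  move/eqP: rN; rewrite psumr_eq0 // => /allP/(_ i).
  by rewrite mem_index_enum => /(_ isT)/eqP ->; rewrite scale0r.
- have [j rj] := vertex r y' r0 rN y'r.
  by have := r1 j; rewrite rj eqxx ltxx.
- have [[i [j [z e]]]|[z e]] := parity_classes y' TS uS.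
    have [a [b rab]] := half_lattice_point TS uS r0 rN y'r e.
    by have := r1 a; rewrite rab eqxx ltNge lerDl ler0n.
  (* When [y'] has the class of the vertex sum, the complementary point [y''] is even, so it has the
     class of a doubled vertex. Its weights [1 - r i] are then supported on at most two indices,
     which forces [r p = 1] at a third one. *)
  have e2 : y'' = u o0 + u o0 + (- z - u o0) *+ 2.
    rewrite /y'' e; apply/colP => i; mx_lia.
  have r0' i : 0 <= 1 - r i by rewrite subr_ge0 ltW.
  have [a [b rab]] := half_lattice_point TS uS r0' sN y''r e2.
  have [p /andP[/negPf pa /negPf pb]] := third_index a b.
  by have := r1 p; rewrite -subr_gt0 rab pa pb addr0 ltxx.
- have r0' i : 0 <= 1 - r i by rewrite subr_ge0 ltW.
  have [j rj] := vertex _ y'' r0' sN y''r.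
  have [p /andP[/negPf pj _]] := third_index j j.
  by have := r1 p; rewrite -subr_gt0 rj pj ltxx.
Qed.

Lemma nneg_int_pick m (k : 'I_m -> int) (N : nat) :
  (forall i, 0 <= k i) -> \sum_i k i = N.+1%:Z ->
  exists i, (forall p, 0 <= k p - (p == i)%:R) /\
            \sum_p (k p - (p == i)%:R) = N%:Z.
Proof.
move=> k0 kN.
have [i ki] : exists i, 0 < k i.
  apply/existsP; apply: contraT; rewrite negb_exists => /forallP h.
  have : \sum_i k i = 0.
    by apply: big1 => i _; apply: le_anti; rewrite k0 leNgt h.
  by rewrite kN.
exists i; split=> [p|]; last by rewrite big_split /= sumrN kN sum_delta; lia.
by case: eqVneq => [->|_]; [rewrite subr_ge0; lia|rewrite subr0 k0].
Qed.

Lemma nneg_int_sum2 m (k : 'I_m -> int) :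
  (forall i, 0 <= k i) -> \sum_i k i = 2 ->
  exists i j, forall p, k p = (p == i)%:R + (p == j)%:R.
Proof.
move=> k0 k2.
have [i [i0 i1]] := nneg_int_pick (N := 1) k0 k2.
have [j [j0 /eqP j1]] := nneg_int_pick (N := 0) i0 i1.
exists i, j => p; move: j1; rewrite psumr_eq0 // => /allP/(_ p).
by rewrite mem_index_enum => /(_ isT); rewrite -addrA -opprD subr_eq0 => /eqP.
Qed.

(* By unimodularity the half-lattice point (u_0 + u_1 + u_2 + u_3) / 2 is the
   midpoint of an edge of any simplex that contains it. *)
Lemma center_edge S u : T S -> lattice_simplex u S ->
  exists S' u' i j, [/\ T S', lattice_simplex u' S', i != j
    & u' i + u' j = \sum_p u p].
Proof.
move=> TS uS; pose W := \sum_p u p.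
have : (\bigcup_(S in T) S) (2^-1 *: int_vec R W) by rewrite (pt_cover hT).
move=> [S' TS' WS']; have [u' u'S'] := lattice_simplexE hT TS'.
(* Integral coordinates with sum 1 exist for every lattice point. Subtracting one vertex first and
   adding it back gives coordinates [l] of [W] with sum 2; their halves are the barycentric
   coordinates of [W / 2] in [S'], hence nonnegative. *)
have [k k1 Wk] := unimodular (W - u' o0) TS' u'S'.
pose l p := k p + (p == o0)%:R.
have l2 : \sum_p l p = 2 by rewrite big_split /= k1 sum_delta.
have Wl : W = \sum_p l p *: u' p.
  under eq_bigr do rewrite scalerDl.
  by rewrite big_split /= sum_scale_delta -Wk subrK.
have l0 p : 0 <= l p.
  have [c [c0 c1 Wc]] := (simplex_memP _ u'S').1 WS'.
  suff /(_ p) cl : c =1 fun p => 2^-1 * (l p)%:~R.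
    have := c0 p; rewrite cl pmulr_rge0 ?invr_gt0 ?ltr0n //.
    by rewrite ler0z.
  apply: (barycentric_inj u'S'.1).
    by rewrite c1 -mulr_sumr -rmorph_sum l2 mulVf // pnatr_eq0.
  rewrite -Wc Wl int_vec_sum scaler_sumr.
  by apply: eq_bigr => q _; rewrite scalerA.
have [i [j lij]] := nneg_int_sum2 l0 l2.
have E : u' i + u' j = W.
  rewrite Wl; under [RHS]eq_bigr do rewrite lij scalerDl.
  by rewrite big_split /= !sum_scale_delta.
exists S', u', i, j; split => //; apply/eqP => ij.
apply: (vertex_sum_not_congr (b := o0) (d := o0) (z := u' i - u o0) TS uS).
by rewrite -/W -E ij; apply/colP => p; mx_lia.
Qed.

Lemma edge_congr_oriented S S' u u' i j a b z : T S -> T S' ->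
  lattice_simplex u S -> lattice_simplex u' S' ->
  u' i + u' j = u a + u b + z *+ 2 ->
  exists a' b', u' i - u' j = u a' - u b' /\ u' i + u' j = u a' + u b' + z *+ 2.
Proof.
move=> TS TS' uS u'S' e.
have [d|d] := edge_congr hT TS TS' uS u'S' e; first by exists a, b.
by exists b, a; split; [rewrite d opprB|rewrite e [u b + u a]addrC].
Qed.

(* The two other sides of a triangle on the edge through the centre are
   translates of opposite edges of S, which gives the direction of the edge. *)
Lemma opposite_edges S u : T S -> lattice_simplex u S ->
  exists v, lattice_simplex v S /\ exists S' u' i j,
    [/\ T S', lattice_simplex u' S', u' i + u' j = \sum_p v p
      & u' i - u' j = v o1 - v o0 + v o3 - v o2].
Proof.
move=> TS uS.
have [S' [u' [i [j [TS' u'S' ij E]]]]] := center_edge TS uS.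
have [r /andP[ri rj]] := third_index i j.
(* A side of the triangle [i], [r], [j] is either in the class of the vertex sum or a translate of
   an edge of [S]. The first case is impossible for the sides at [r], since the edge from [i] to [j]
   has that class already and the third side would then have an even sum. *)
have side p q : p != q ->
    (exists t, u' p + u' q + t *+ 2 = \sum_p u p + u' p *+ 2) \/
    exists a b z, u' p - u' q = u a - u b /\ u' p + u' q = u a + u b + z *+ 2.
  move=> pq; have [[a [b [z e]]]|[z e]] := parity_classes (u' p + u' q) TS uS.
    right; have [a' [b' e']] := edge_congr_oriented TS TS' uS u'S' e.
    by exists a', b', z.
  by left; exists (u' p - z); rewrite e; apply/colP => k; mx_lia.
have [|[t e]|[a [b [z1 [d1 e1]]]]] := side i r; first by rewrite eq_sym.
  have e' : u' r + u' j = (u' j + u' i - t) *+ 2.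
    by apply/colP => k; move/colP: e => /(_ k); rewrite -E; mx_lia.
  by rewrite (vertex_sum_neq_even hT TS' u'S' e') eqxx in rj.
have [|[t e]|[c [d [z2 [d2 e2]]]]] := side r j; first exact: rj.
  have e' : u' i + u' r = t *+ 2.
    apply/colP => k; move/colP: e => /(_ k); rewrite -E; mx_lia.
  by rewrite (vertex_sum_neq_even hT TS' u'S' e') eqxx in ri.
(* The four ends [a], [b], [c], [d] are all the vertices of [S]: any coincidence between the two
   edges would cancel modulo 2 and put the vertex sum in the class of a pair. *)
have W : \sum_p u p = u a + u b + (u c + u d) + (z1 + z2 - u' r) *+ 2.
  by rewrite -E; apply/colP => k; move/colP: e1 => /(_ k);
    move/colP: e2 => /(_ k); mx_lia.
have ab : a != b.
  apply/eqP => ab; move: d1; rewrite ab subrr => /eqP; rewrite subr_eq0.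
  move=> /eqP /(lattice_simplex_vertex_inj u'S') ir.
  by rewrite ir eqxx in ri.
have cd : c != d.
  apply/eqP => cd; move: d2; rewrite cd subrr => /eqP; rewrite subr_eq0.
  move=> /eqP /(lattice_simplex_vertex_inj u'S') rj'.
  by rewrite rj' eqxx in rj.
have NW (k l : 'I_4) z : \sum_p u p <> u k + u l + z *+ 2.
  exact: (vertex_sum_not_congr (z := z) TS uS).
have ac : a != c.
  apply/eqP => ac; apply: (NW b d (z1 + z2 - u' r + u c)); rewrite W ac.
  by apply/colP => k; mx_lia.
have ad : a != d.
  apply/eqP => ad; apply: (NW b c (z1 + z2 - u' r + u d)); rewrite W ad.
  by apply/colP => k; mx_lia.
have bc : b != c.
  apply/eqP => bc; apply: (NW a d (z1 + z2 - u' r + u c)); rewrite W bc.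
  by apply/colP => k; mx_lia.
have bd : b != d.
  apply/eqP => bd; apply: (NW a c (z1 + z2 - u' r + u d)); rewrite W bd.
  by apply/colP => k; mx_lia.
(* This order turns [(u a - u b) + (u c - u d)], the direction from [u' j] to [u' i], into
   [v o1 - v o0 + v o3 - v o2]. *)
have /perm_I4[s [s0 s1 s2 s3]] : uniq [:: b; a; d; c].
  by rewrite /= !inE !negb_or (eq_sym b a) (eq_sym d c) ab cd ac ad bc bd.
exists (u \o s); split; first exact: lattice_simplex_perm.
exists S', u', i, j; split => //.
  by rewrite E (reindex_inj (@perm_inj _ s)).
rewrite /= s0 s1 s2 s3; apply/colP => k.
by move/colP: d1 => /(_ k); move/colP: d2 => /(_ k); mx_lia.
Qed.

(* In the basis of the steps v_(i+1) - v_i, with v as in opposite_edges, the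
   edges of S are indicators of intervals, and the seventh direction is
   (1, 0, 1). *)
Lemma zero_one_basis : exists2 G : 'M[int]_3, G \in unitmx &
  forall S u, T S -> lattice_simplex u S -> forall i j,
  exists2 x : 'cV[int]_3, forall k, 0 <= x k 0 <= 1 &
    u i - u j = G *m x \/ u i - u j = - (G *m x).
Proof.
have : (\bigcup_(S in T) S) 0 by rewrite (pt_cover hT).
move=> [S TS _]; have [u uS] := lattice_simplexE hT TS.
have [v [vS [S' [u' [i' [j' [TS' u'S' Ew w]]]]]]] := opposite_edges TS uS.
pose G : 'M[int]_3 := \matrix_(i, j)
  (v (lift ord0 j) - v (widen_ord (leqnSn 3) j)) i 0.
(* Coordinates of [v a - v o0] in the basis of steps: the first [a] entries are 1. *)
pose chi (a : 'I_4) : 'cV[int]_3 := \col_(m < 3) (m < a)%N%:R.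
have lE (j : 'I_3) (i : 'I_4) : j.+1 = i -> lift ord0 j = i.
  by move=> ji; apply: val_inj; rewrite /= /bump leq0n.
have wE (j : 'I_3) (i : 'I_4) : j = i :> nat -> widen_ord (leqnSn 3) j = i.
  by move=> ji; apply: val_inj.
have GE (x : 'cV[int]_3) : G *m x = x p0 0 *: (v o1 - v o0)
    + x p1 0 *: (v o2 - v o1) + x p2 0 *: (v o3 - v o2).
  apply/colP => k; rewrite mxE sum_I3 !(mxE, lE p0 o1, lE p1 o2, lE p2 o3) //.
  by rewrite (wE p0 o0) // (wE p1 o1) // (wE p2 o2) //; ring.
have Gchi a b : v a - v b = G *m (chi a - chi b).
  rewrite GE !mxE.
  by case: (I4P a) => ->; case: (I4P b) => -> /=; apply/colP => k; mx_lia.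
exists G.
  have /choice[X XP] : forall y, exists x, G *m x = y.
    move=> y; have [k k1 yk] := unimodular (y + v o0) TS vS.
    (* Summation by parts: the coefficient of step [m] is the sum of the [k i] with [i > m]. *)
    exists (\col_(m < 3) (k o1 *+ (m < 1)%N + k o2 *+ (m < 2)%N + k o3)).
    rewrite GE !mxE /=; move: k1 yk; rewrite !sum_I4 => k1 yk.
    apply/colP => m; move/colP: yk => /(_ m); rewrite !mxE.
    have -> : k o0 = 1 - k o1 - k o2 - k o3 by lia.
    by move=> yk; apply: (addIr (v o0 m 0)); rewrite yk; ring.
  have : G *m (\matrix_(i, j) X (col j 1%:M) i 0) = 1%:M.
    apply/matrixP => i j; move/colP: (XP (col j 1%:M)) => /(_ i).
    rewrite !mxE => <-; apply: eq_bigr => k _; by rewrite !mxE.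
  by case/mulmx1_unit.
move=> S1 u1 TS1 u1S1 i j.
have [[a [b [z e]]]|[z e]] := parity_classes (u1 i + u1 j) TS vS.
  have [a' [b' [d _]]] := edge_congr_oriented TS TS1 vS u1S1 e.
  rewrite d; case: (leqP b' a') => ab.
    exists (chi a' - chi b'); last by left.
    move=> k; rewrite !mxE; case: (ltnP k a') => h1; case: (ltnP k b') => h2 //=.
    by have := leq_trans h2 (leq_trans ab h1); rewrite ltnn.
  exists (chi b' - chi a'); last by right; rewrite -Gchi opprB.
  move=> k; rewrite !mxE; case: (ltnP k b') => h1; case: (ltnP k a') => h2 //=.
  by have := leq_trans h2 (leq_trans (ltnW ab) h1); rewrite ltnn.
exists (chi o1 - chi o0 + chi o3 - chi o2).
  by move=> k; case: (I3P k) => ->; rewrite !mxE.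
have -> : G *m (chi o1 - chi o0 + chi o3 - chi o2) =
    v o1 - v o0 + v o3 - v o2.
  by rewrite -addrA mulmxDr -!Gchi addrA.
rewrite -w; apply: (edge_congr hT TS' TS1 u'S' u1S1 (z := z)).
by rewrite Ew.
Qed.

End Dimension3.

(** * The Freudenthal triangulation in dimension [n] *)

Section Freudenthal.
Variables (R : realType) (n : nat).
Implicit Types (S : set 'cV[R]_n) (u : 'I_n.+1 -> 'cV[int]_n).

Lemma sorting_perm d (V : orderType d) m (f : 'I_m -> V) :
  exists s : 'S_m, forall i j : 'I_m, (i <= j)%N -> (f (s i) <= f (s j))%O.
Proof.
pose e := sort (relpre f <=%O) (enum 'I_m).
have eS : size e = m by rewrite size_sort size_enum_ord.
have eU : uniq e by rewrite sort_uniq enum_uniq.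
have sI : injective (fun i : 'I_m => nth i e i).
  move=> i j /eqP; rewrite (set_nth_default i j) ?eS // nth_uniq ?eS //.
  by move=> /eqP/val_inj.
exists (perm sI) => i j ij; rewrite !permE (set_nth_default i j) ?eS //.
have tr : transitive (relpre f <=%O) by move=> y x z; exact: le_trans.
apply: (sorted_leq_nth tr) => //; rewrite ?inE ?eS //.
- by move=> x /=.
- by apply: sort_sorted => x y /=; exact: le_total.
Qed.

(** A description of the Kuhn simplices without permutations. Together with the affine independence
    in [lattice_simplex], it forces each step of the chain to raise exactly one entry by 1. *)
Definition unit_chain u : Prop := forall (i j : 'I_n.+1) m, (i <= j)%N ->
  u i m 0 <= u j m 0 <= u i m 0 + 1.

Definition freudenthal : set (set 'cV[R]_n) :=
  [set S | exists2 u, lattice_simplex u S & unit_chain u].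

(* The vertices carrying a point x are recovered from x alone, as the floors of
   x + (theta, ..., theta) for theta in [0, 1[. *)
Lemma unit_chain_floor u (c : 'I_n.+1 -> R) (theta : R) (k : 'I_n.+1) m :
  unit_chain u -> (forall i, 0 <= c i) -> \sum_i c i = 1 ->
  \sum_(j < n.+1 | (j < k)%N) c j <= theta < \sum_(j < n.+1 | (j <= k)%N) c j ->
  u k m 0 = Num.floor ((\sum_i c i *: int_vec R (u i)) m 0 + theta).
Proof.
move=> uC c0 c1 /andP[t1 t2]; apply/esym/floor_def.
pose a j : R := (u j m 0)%:~R.
have -> : (\sum_i c i *: int_vec R (u i)) m 0 = \sum_i c i * a i.
  by rewrite summxE; apply: eq_bigr => i _; rewrite !mxE.
have X : \sum_i c i * a i = a k + \sum_i c i * (a i - a k).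
  under [in RHS]eq_bigr do rewrite mulrBr.
  by rewrite big_split /= sumrN -mulr_suml c1 mul1r addrCA subrr addr0.
have ale (i j : 'I_n.+1) : (i <= j)%N -> a i <= a j <= a i + 1.
  by move=> /(uC _ _ m)/andP[h1 h2]; rewrite ler_int h1 -intrD1 ler_int.
(* Vertices before [k] lie at most 1 below [a k] and later ones at most 1 above it; the two bounds
   on [theta] absorb these deviations. *)
rewrite intrD1 -/(a k) X; apply/andP; split.
  rewrite -addrA lerDl -lerBlDr sub0r.
  rewrite (le_trans (y := - \sum_(j < n.+1 | (j < k)%N) c j)) ?lerN2 //.
  rewrite big_mkcond /= -sumrN; apply: ler_sum => i _.
  case: ltnP => ik; rewrite ?oppr0.
    rewrite -mulrN1 ler_wpM2l //; have /andP[] := ale _ _ (ltnW ik); lra.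
  by rewrite mulr_ge0 //; have /andP[] := ale _ _ ik; lra.
rewrite -addrA ltrD2l -ltrBrDl; apply: (lt_le_trans t2).
rewrite -[X in X - _]c1 -sumrN -big_split /= big_mkcond /=; apply: ler_sum => i _.
rewrite -[X in X - _]mulr1 -mulrBr.
case: leqP => ik.
  rewrite -[X in X <= _]mulr1 ler_wpM2l //; have /andP[] := ale _ _ ik; lra.
by rewrite mulr_ge0 //; have /andP[] := ale _ _ (ltnW ik); lra.
Qed.

Lemma threshold_index (c : 'I_n.+1 -> R) (theta : R) :
  \sum_i c i = 1 -> 0 <= theta < 1 -> exists k : 'I_n.+1,
  \sum_(j < n.+1 | (j < k)%N) c j <= theta < \sum_(j < n.+1 | (j <= k)%N) c j.
Proof.
move=> c1 /andP[t0 t1].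
pose B p := \sum_(j < n.+1 | (j < p)%N) c j.
have Bn : exists p, theta < B p.
  exists n.+1; rewrite /B (eq_bigl xpredT) ?c1 // => j; exact: ltn_ord.
have Bn1 : theta < B n.+1.
  by rewrite /B (eq_bigl xpredT) ?c1 // => j; exact: ltn_ord.
case: (ex_minnP Bn) => -[|p] tp pmin.
  by move: tp; rewrite /B big_pred0 // ltNge t0.
exists (Ordinal (pmin _ Bn1)) => /=; rewrite tp andbT leNgt.
by apply/negP => /pmin; rewrite ltnn.
Qed.

(** Take for [theta] the total weight before [k]. The floors of the point shifted by [theta] give
    [u k] when computed in the first simplex and a vertex of [S'] when computed in the second. *)
Lemma freudenthal_support S' u u' (c : 'I_n.+1 -> R) k :
  unit_chain u -> unit_chain u' -> lattice_simplex u' S' ->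
  (forall i, 0 <= c i) -> \sum_i c i = 1 -> S' (\sum_i c i *: int_vec R (u i)) ->
  c k != 0 -> exists l, u k = u' l.
Proof.
move=> uC u'C u'S c0 c1 /(simplex_memP _ u'S)[c' [c'0 c'1 cc']] ck.
pose theta := \sum_(j < n.+1 | (j < k)%N) c j.
have tS : \sum_(j < n.+1 | (j <= k)%N) c j = c k + theta.
  rewrite (bigD1 k) //=; congr (_ + _); apply: eq_bigl => j.
  by rewrite andbC -(inj_eq val_inj) -ltn_neqAle.
have tk : theta <= theta < \sum_(j < n.+1 | (j <= k)%N) c j.
  by rewrite lexx tS ltrDr lt_neqAle eq_sym ck c0.
have t01 : 0 <= theta < 1.
  rewrite sumr_ge0 //=; move/andP: tk => [_ /lt_le_trans]; apply.
  rewrite -c1 [X in X <= _]big_mkcond; apply: ler_sum => i _.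
  by case: ifP.
have [l tl] := threshold_index c'1 t01.
exists l; apply/colP => m; rewrite (unit_chain_floor m uC c0 c1 tk).
by rewrite (unit_chain_floor m u'C c'0 c'1 tl) cc'.
Qed.

Lemma freudenthal_face S S' : freudenthal S -> freudenthal S' ->
  face (S `&` S') S.
Proof.
move=> [u uS uC] [u' u'S' u'C].
pose A := [set k | [exists l, u k == u' l]]%SET.
exists (fun i => int_vec R (u i)), A; split => //.
apply/seteqP; split=> [x [/(simplex_memP _ uS)[c [c0 c1 ->]] xS']|x].
  exists c; split => // k; rewrite inE; apply: contraNeq => ck.
  have [l e] := freudenthal_support uC u'C u'S' c0 c1 xS' ck.
  by apply/existsP; exists l; rewrite e.
move=> [c [c0 cA c1 ->]]; split.
  by apply/(simplex_memP _ uS); exists c.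
case: (u'S') => _ ->; apply: hull_convex => // k.
apply: contraNP => h; apply/eqP/cA; apply/negP; rewrite inE => /existsP[l /eqP e].
by apply: h; rewrite e; apply: (hull_vertex (fun i => int_vec R (u' i))); rewrite inE.
Qed.

(** With [e_j] the standard basis, this is [z + e_(s 0) + ... + e_(s (k - 1))]. *)
Definition kuhn_vertex (z : 'cV[int]_n) (s : 'S_n) (k : 'I_n.+1) : 'cV[int]_n :=
  \col_m (z m 0 + (s^-1%g m < k)%N%:R).

Lemma kuhn_unit_chain z s : unit_chain (kuhn_vertex z s).
Proof.
move=> i j m ij; rewrite !mxE.
case: (ltnP (s^-1%g m) i) => h; case: (ltnP (s^-1%g m) j) => h' /=; lia.
Qed.

Lemma kuhn_combination z s (c : 'I_n.+1 -> R) m :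
  (\sum_i c i *: int_vec R (kuhn_vertex z s i)) m 0 =
  (z m 0)%:~R * \sum_i c i + \sum_(i < n.+1 | (s^-1%g m < i)%N) c i.
Proof.
rewrite summxE mulr_sumr [X in _ + X]big_mkcond -big_split /=.
apply: eq_bigr => i _; rewrite !mxE rmorphD /= rmorph_nat mulrDr mulrC.
by case: ifP; rewrite ?mulr1 ?mulr0.
Qed.

(** When the weights sum to 0, entry [s p] of the combination is the tail sum of the weights from
    index [p + 1] on. All tail sums vanish, hence so do their differences. *)
Lemma kuhn_affinely_independent z s :
  affinely_independent (fun i => int_vec R (kuhn_vertex z s i)).
Proof.
move=> c c0 cv.
pose t p := \sum_(i < n.+1 | (p <= i)%N) c i.
have t0 p : t p = 0.
  case: p => [|p]; first by rewrite -[RHS]c0; apply: eq_bigl.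
  case: (ltnP p n) => pn; last first.
    rewrite /t big_pred0 // => i; apply/negbTE; rewrite -leqNgt.
    by rewrite (leq_trans _ pn) // -ltnS.
  have := kuhn_combination z s c (s (Ordinal pn)).
  by rewrite cv mxE c0 mulr0 add0r permK.
move=> i; have := t0 i; rewrite /t (bigD1 i) //=.
have -> : \sum_(j < n.+1 | (i <= j)%N && (j != i)) c j = t i.+1.
  apply: eq_bigl => j; rewrite andbC eq_sym -(inj_eq val_inj).
  by rewrite -ltn_neqAle.
by rewrite t0 addr0.
Qed.

Lemma freudenthal_cover : \bigcup_(S in freudenthal) S = setT.
Proof.
apply/seteqP; split => // x _.
pose z : 'cV[int]_n := \col_m Num.floor (x m 0).
pose fr m : R := x m 0 - (z m 0)%:~R.
have fr0 m : 0 <= fr m by rewrite /fr mxE subr_ge0 floor_le_tmp.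
have fr1 m : fr m <= 1.
  by rewrite /fr mxE lerBlDl -intrD1 ltW // floorD1_gt.
(* The sign sorts the fractional parts in decreasing order. With 1 put in front and the default 0 of
   [nth] behind them, their successive drops are the barycentric weights, and the tail sums of these
   give back the entries of [g]. *)
have [s sP] := sorting_perm (fun m => - fr m).
pose g p := nth 0 (1 :: [seq fr (s i) | i <- enum 'I_n]) p.
have gS (i : 'I_n) : g i.+1 = fr (s i).
  by rewrite /g /= (nth_map i) ?size_enum_ord // nth_ord_enum.
have gn : g n.+1 = 0 by rewrite /g /= nth_default // size_map size_enum_ord.
have gle p : (p <= n)%N -> g p.+1 <= g p.
  case: p => [|p] pn.
    case: (posnP n) => [n0|n0]; first by rewrite -{1}n0 gn /g /= ler01.
    by rewrite (gS (Ordinal n0)) /g /=.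
  rewrite (gS (Ordinal pn)); case: (ltnP p.+1 n) => pn'.
    by rewrite (gS (Ordinal pn')) -lerN2; apply: sP => /=.
  have -> : p.+1 = n by apply/eqP; rewrite eqn_leq pn.
  by rewrite gn.
pose c (k : 'I_n.+1) := g k - g k.+1.
have tail p : (p <= n)%N -> \sum_(i < n.+1 | (p <= i)%N) c i = g p.
  move=> pn; rewrite -(big_geq_mkord _ _ xpredT (fun k => g k - g k.+1)).
  under eq_bigr do rewrite -opprB.
  by rewrite sumrN telescope_sumr ?gn ?sub0r ?opprK // leqW.
exists (hull (fun i => int_vec R (kuhn_vertex z s i)) [set: 'I_n.+1]%SET).
  exists (kuhn_vertex z s); last exact: kuhn_unit_chain.
  split => //; exact: kuhn_affinely_independent.
have c1 : \sum_i c i = 1.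
  by rewrite -[RHS](tail 0%N (leq0n n)); apply: eq_bigl.
exists c; split => // [i|i|]; last first.
- apply/colP => m; rewrite kuhn_combination c1 mulr1 tail ?ltn_ord //.
  by rewrite gS permKV /fr addrC subrK.
- by rewrite inE.
- by rewrite subr_ge0 gle // -ltnS.
Qed.

Lemma freudenthal_periodic_triangulation : periodic_triangulation freudenthal.
Proof.
have transl z S : freudenthal S -> freudenthal [set x + int_vec R z | x in S].
  move=> [u /(lattice_simplex_translate z) uS uC]; exists (fun i => u i + z) => //.
  by move=> i j m /(uC _ _ m)/andP[h1 h2]; rewrite !mxE addrAC !lerD2r h1.
split.
- by move=> S [u uS _]; exists (fun i => int_vec R (u i)).
- apply/seteqP; split => [x [S [u uS _] [v [vS [i ->]]]]|x [z _ <-]].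
    by have [j ->] := simplex_vertices_range i vS uS; exists (u j).
  have : (\bigcup_(S in freudenthal) S) (int_vec R z) by rewrite freudenthal_cover.
  move=> [S FS Sz]; exists S => //; have [u uS uC] := FS.
  have [c [c0 c1 zc]] := (simplex_memP _ uS).1 Sz.
  (* For threshold 0 the recovered vertex is the floor of the point itself, which is [z] at a
     lattice point. *)
  have t01 : 0 <= (0 : R) < 1 by rewrite lexx ltr01.
  have [k tk] := threshold_index c1 t01.
  exists (fun i => int_vec R (u i)); split => //; exists k; congr (int_vec _ _).
  apply/colP => m; rewrite (unit_chain_floor m uC c0 c1 tk) -zc addr0 mxE.
  by rewrite intrKfloor.
- exact: freudenthal_cover.
- move=> S S' FS FS'; split; first exact: freudenthal_face.
  by rewrite setIC; exact: freudenthal_face.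
- move=> z; apply/seteqP; split => [_ [S FS <-]|S FS]; first exact: transl.
  exists [set x + int_vec R (- z) | x in S]; first exact: transl.
  rewrite image_comp -[RHS]image_id; apply: eq_imagel => x _ /=.
  by rewrite -addrA -int_vecD addNr /int_vec raddf0 addr0.
Qed.

End Freudenthal.

(** * Simplices sharing a barycenter *)

Section Equality.
Variables (R : realType) (n : nat) (T : set (set 'cV[R]_n)).
Hypothesis hT : periodic_triangulation T.

Lemma injective_family_perm (V : Type) m (v w : 'I_m -> V) :
  injective v -> (forall i, exists j, v i = w j) ->
  exists s : 'S_m, v = w \o s.
Proof.
move=> vI /choice[h vh].
have hI : injective h by move=> i j hij; apply: vI; rewrite !vh hij.
by exists (perm hI); apply: funext => i; rewrite /= permE.
Qed.

(** All weights of the barycenter are nonzero, so the common face containing it has every vertex of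
    [S]. These are lattice points of [S'], hence its vertices. *)
Lemma simplex_eq_of_barycenter S S' (u : 'I_n.+1 -> 'cV[int]_n) :
  T S -> T S' -> lattice_simplex u S ->
  S' (\sum_i (n.+1%:R)^-1 *: int_vec R (u i)) -> S = S'.
Proof.
move=> TS TS' uS bS'; have [u' u'S'] := lattice_simplexE hT TS'.
pose U i := int_vec R (u i).
have UI : injective U by move=> i j /int_vec_inj /(lattice_simplex_vertex_inj uS).
have w1 : \sum_(i < n.+1) (n.+1%:R)^-1 = 1 :> R.
  by rewrite sumr_const card_ord -[_ *+ _]mulr_natl mulfV // pnatr_eq0.
have [[v [A [vS SA]]] _] := pt_faces hT TS TS'.
have [s Us] := injective_family_perm UI (fun i => simplex_vertices_range i uS vS).
have b : (S `&` S') (\sum_i (n.+1%:R)^-1 *: v i).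
  have -> : \sum_i (n.+1%:R)^-1 *: v i = \sum_i (n.+1%:R)^-1 *: U i.
    by rewrite (reindex_inj (@perm_inj _ s)) Us.
  split => //; apply/(simplex_memP _ uS); exists (fun=> (n.+1%:R)^-1).
  by split => // i; rewrite invr_ge0 ler0n.
have US' i : S' (U i).
  rewrite Us /=; suff : (S `&` S') (v (s i)) by case.
  rewrite SA; apply: hull_vertex; rewrite SA in b.
  by apply: (hull_support vS.1 w1 b); rewrite invr_eq0 pnatr_eq0.
have [|t ut] := injective_family_perm (w := u') (lattice_simplex_vertex_inj uS).
  by move=> i; apply: (lattice_point_vertex hT TS' u'S'); exact: US'.
case: (uS) => _ ->; case: (u'S') => _ ->.
by rewrite -(hull_perm (fun i => int_vec R (u' i)) t) ut.
Qed.

End Equality.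

(** * Action of integral matrices on simplices and triangulations *)

Section IntegralLinearMaps.
Variables (R : realType) (n : nat).
Implicit Types (S : set 'cV[R]_n) (T : set (set 'cV[R]_n)) (g h : 'M[int]_n).

Lemma lattice_simplex_image g (u : 'I_n.+1 -> 'cV[int]_n) S : g \in unitmx ->
  lattice_simplex u S ->
  lattice_simplex (fun i => g *m u i) [set map_mx intr g *m x | x in S].
Proof.
move=> gU uS; pose M : 'M[R]_n := map_mx intr g.
have MK : map_mx intr (invmx g) *m M = 1%:M by rewrite -map_mxM mulVmx // map_mx1.
have ME i : int_vec R (g *m u i) = M *m int_vec R (u i) by exact: map_mxM.
have Msum (c : 'I_n.+1 -> R) :
    \sum_i c i *: int_vec R (g *m u i) = M *m \sum_i c i *: int_vec R (u i).
  by rewrite mulmx_sumr; apply: eq_bigr => i _; rewrite ME scalemxAr.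
split.
  move=> c c0; rewrite Msum => /(congr1 (mulmx (map_mx intr (invmx g)))).
  by rewrite mulmxA MK mul1mx mulmx0; exact: uS.1.
apply/seteqP; split => [_ [x /(simplex_memP _ uS)[c [c0 c1 ->]] <-]|x].
  by exists c; split => // i; rewrite inE.
move=> [c [c0 _ c1 ->]]; rewrite Msum; exists (\sum_i c i *: int_vec R (u i)) => //.
by apply/(simplex_memP _ uS); exists c.
Qed.

Lemma int_mx_image_mul g h T :
  int_mx_image g (int_mx_image h T) = int_mx_image (g *m h) T.
Proof.
rewrite /int_mx_image image_comp; apply: eq_imagel => S _ /=.
by rewrite image_comp; apply: eq_imagel => x _ /=; rewrite map_mxM mulmxA.
Qed.

Lemma int_mx_image1 T : int_mx_image 1%:M T = T.
Proof.
rewrite -[RHS]image_id; apply: eq_imagel => S _ /=.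
rewrite -[RHS]image_id; apply: eq_imagel => x _ /=.
by rewrite map_mx1 mul1mx.
Qed.

End IntegralLinearMaps.

(** In the basis of [zero_one_basis] every simplex of [T] becomes a Freudenthal simplex. Conversely,
    the image of [T] covers the barycenter of any Freudenthal simplex, and the simplex covering it
    must be that one. *)
Lemma equivalent_to_freudenthal (R : realType) (T : set (set 'cV[R]_3)) :
  periodic_triangulation T ->
  exists2 g : 'M[int]_3, g \in unitmx & int_mx_image g T = @freudenthal R 3.
Proof.
move=> hT; have [G GU GE] := zero_one_basis hT.
exists (invmx G); first by rewrite unitmx_inv.
set g := invmx G.
have gT S : T S -> @freudenthal R 3 [set map_mx intr g *m x | x in S].
  move=> TS; have [u uS] := lattice_simplexE hT TS.
  pose w i := g *m u i.
  (* Vertices differ by 0/1 vectors up to sign, so they are comparable entrywise and the sum of the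
     entries orders them. *)
  have [s sP] := sorting_perm (fun i => \sum_m w i m 0).
  exists (w \o s).
    by apply: lattice_simplex_perm; apply: lattice_simplex_image; rewrite ?unitmx_inv.
  have wB a b : w a - w b = g *m (u a - u b) by rewrite mulmxBr.
  clearbody w; move=> i j m ij; have [x x01 xE] := GE S u TS uS (s j) (s i).
  have wE := wB (s j) (s i); case: xE => xE.
    have {}wE : w (s j) = w (s i) + x.
      by apply/eqP; rewrite addrC -subr_eq wE xE mulmxA mulVmx // mul1mx.
    by rewrite /= wE mxE lerDl lerD2l; exact: x01.
  have {}wE : w (s i) = w (s j) + x.
    apply/eqP; rewrite addrC -subr_eq -opprB wE xE mulmxN opprK.
    by rewrite mulmxA mulVmx // mul1mx.
  (* In this case the order by sums goes against the sign of [x], so the two vertices coincide. *)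
  have x0 k : x k 0 = 0.
    have : \sum_k x k 0 <= 0.
      move: (sP i j ij); rewrite wE.
      under eq_bigr do rewrite mxE.
      by rewrite big_split /= gerDl.
    have xge q : true -> 0 <= x q 0 by case/andP: (x01 q).
    move=> xs; have /eqP : \sum_k x k 0 = 0.
      by apply: le_anti; rewrite xs sumr_ge0.
    rewrite psumr_eq0 // => /allP/(_ k).
    by rewrite mem_index_enum => /(_ isT)/eqP.
  by rewrite /= wE mxE x0 addr0 lexx lerDl.
apply/seteqP; split => [_ [S TS <-]|S' FS']; first exact: gT.
have [u' u'S' _] := FS'.
pose b : 'cV[R]_3 := \sum_i (4%:R)^-1 *: int_vec R (u' i).
have : (\bigcup_(S in T) S) (map_mx intr G *m b) by rewrite (pt_cover hT).
move=> [S TS Sb]; exists S => //; apply/esym.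
apply: (simplex_eq_of_barycenter (@freudenthal_periodic_triangulation R 3) FS'
  (gT S TS) u'S').
exists (map_mx intr G *m b) => //.
by rewrite mulmxA -map_mxM mulVmx // map_mx1 mul1mx.
Qed.

Theorem theorem4p5 (R : realType) :
  (exists T : set (set 'cV[R]_3), periodic_triangulation T) /\
  (forall T T' : set (set 'cV[R]_3),
     periodic_triangulation T -> periodic_triangulation T' ->
     GLZ_equivalent T T').
Proof.
split; first by exists (@freudenthal R 3); exact: freudenthal_periodic_triangulation.
move=> T T' /equivalent_to_freudenthal[g gU gT] /equivalent_to_freudenthal[h hU hT].
exists (invmx h *m g); first by rewrite unitmx_mul unitmx_inv hU.
by rewrite -int_mx_image_mul gT -hT int_mx_image_mul mulVmx // int_mx_image1.
Qed.
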